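(* Assume the missing-at-random setting below. Then: (i) for every $1\le k\le n_{\mathcal S1}$ and $c\in\mathbb R$, $\mathbb P(p_{\texttt t,k,c,\mathcal S}\le\alpha\text{ and }H^{\texttt{to}}_{k,c}\text{ holds})\le\alpha$ for all $\alpha\in(0,1)$, where $H^{\texttt{to}}_{k,c}:\sum_{i\in\mathcal S}Z_i\mathbf 1\{\tau_i>c\}\le n_{\mathcal S1}-k$ (equivalently $\tau_{\texttt{to}(k)}\le c$); (ii) for every $1\le k\le n_{\mathcal S1}$, $\mathcal I^\alpha_{\texttt{to},k}:=\{c\in\mathbb R:p_{\texttt t,k,c,\mathcal S}>\alpha\}$ satisfies $\mathbb P(\tau_{\texttt{to}(k)}\in\mathcal I^\alpha_{\texttt{to},k})\ge1-\alpha$ and is a one-sided interval of the form $[\hat\tau_{\texttt{to}(k)},\infty)$ or $(\hat\tau_{\texttt{to}(k)},\infty)$ with $\hat\tau_{\texttt{to}(k)}=\inf\mathcal I^\alpha_{\texttt{to},k}$; (iii) $\mathbb P(\tau_{\texttt{to}(k)}\in\mathcal I^\alpha_{\texttt{to},k}\text{ for all }1\le k\le n_{\mathcal S1})\ge1-\alpha$.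
   Context: There are $n$ units with fixed potential outcomes $Y_i^\star(0),Y_i^\star(1)\in\mathbb R$; $\tau_i=Y_i^\star(1)-Y_i^\star(0)$. Missing at random: the pairs $(M_i(1),M_i(0))\in\{0,1\}^2$ are random, i.i.d. over $i$, with $\mathbb P((M_i(1),M_i(0))=(m,m'))=p_{mm'}$ for constants $p_{11},p_{10},p_{01},p_{00}$ summing to 1 not depending on the potential outcomes. $\boldsymbol Z\in\{0,1\}^n$ is uniform over vectors with exactly $n_1$ ones ($n_1,n_0\ge1$ fixed, $n_1+n_0=n$), independent of the potential outcomes and potential missingness. $M_i=Z_iM_i(1)+(1-Z_i)M_i(0)$; the realized outcome $Z_iY_i^\star(1)+(1-Z_i)Y_i^\star(0)$ is observed, denoted $Y_i$, iff $M_i=1$. $\mathcal S=\{i:M_i=1\}$, $n_{\mathcal S1}=\sum_{i\in\mathcal S}Z_i$, $n_{\mathcal S0}=|\mathcal S|-n_{\mathcal S1}$; $\tau_{\texttt{to}(1)}\le\dots\le\tau_{\texttt{to}(n_{\mathcal S1})}$ are the sorted $\tau_i$ over $i\in\mathcal S$ with $Z_i=1$. Statistics: $\overline{\mathbb R}=\mathbb R\cup\{\pm\infty\}$; $\psi_{i,j}(y,y')=\mathbf 1\{y>y'\}+\mathbf 1\{y=y'\}\mathbf 1\{i\ge j\}$; $\mathrm{rank}_i(\boldsymbol y)=\sum_j\psi_{i,j}(y_i,y_j)$; $\phi$ nondecreasing real function on nonnegative integers; $t_{\mathrm R,\phi}(\boldsymbol z,\boldsymbol y)$ is either $\sum_iz_i\phi(\mathrm{rank}_i(\boldsymbol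 y))$ or $\sum_iz_i\phi(\sum_j(1-z_j)\psi_{i,j}(y_i,y_j))$ (either choice). $t_{\mathrm R,\phi,\mathcal S}(\boldsymbol z,\boldsymbol y)=t_{\mathrm R,\phi}(\boldsymbol z_{\mathcal S},\boldsymbol y_{\mathcal S})$ (subvectors indexed by $\mathcal S$, original order); $G_{\mathrm R,\phi,\mathcal S}(c)=\mathbb P(t_{\mathrm R,\phi,\mathcal S}(\boldsymbol A,\boldsymbol y_0)\ge c)$ with $\boldsymbol A_{\mathcal S}$ uniform over assignments of $\mathcal S$ with exactly $n_{\mathcal S1}$ treated ($\mathcal S,n_{\mathcal S1}$ held fixed) and $\boldsymbol y_0\in\mathbb R^n$ fixed. p-value: write $\{i:Z_i=M_i=1\}=\{j_1,\dots,j_{n_{\mathcal S1}}\}$ with $\psi_{j_{l+1},j_l}(Y_{j_{l+1}},Y_{j_l})=1$; $\mathcal J_L=\{j_{n_{\mathcal S1}-L+1},\dots,j_{n_{\mathcal S1}}\}$ for $L\ge1$, $\mathcal J_0=\emptyset$. Let $\boldsymbol v\in\overline{\mathbb R}^n$ with $v_i=-\infty$ for $i\in\mathcal J_{n_{\mathcal S1}-k}$ and $v_i=Y_i-cZ_i$ for other $i\in\mathcal S$. Then $p_{\texttt t,k,c,\mathcal S}=G_{\mathrm R,\phi,\mathcal S}(t_{\mathrm R,\phi,\mathcal S}(\boldsymbol Z,\boldsymbol v))$. *)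

(* Defs.v *)
From HB Require Import structures.
From mathcomp Require Import all_boot all_order all_algebra.
From mathcomp Require Import boolp classical_sets reals constructive_ereal ereal.
Set Implicit Arguments. Unset Strict Implicit. Unset Printing Implicit Defensive.
Import Order.TTheory GRing.Theory Num.Theory.
Local Open Scope ring_scope.
Local Open Scope classical_set_scope.

Section Defs.
Variable R : realType.
Variable n : nat.

(* psi_{i,j}(y,y') = 1{y > y'} + 1{y = y'} 1{i >= j}  (the two indicators are disjoint) *)
Definition psi (i j : 'I_n) (y y' : \bar R) : nat :=
  nat_of_bool ((y' < y)%E || ((y == y') && (j <= i)%N)).

(* rank_i of the subvector y_S : sum over j in S (original order kept) *)
Definition rank_in (S : {set 'I_n}) (y : 'I_n -> \bar R) (i : 'I_n) : nat :=
  \sum_(j in S) psi i j (y i) (y j).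

Definition rank_ctrl (S z : {set 'I_n}) (y : 'I_n -> \bar R) (i : 'I_n) : nat :=
  \sum_(j in S | j \notin z) psi i j (y i) (y j).

Definition t_stat (choice : bool) (phi : nat -> R) (S z : {set 'I_n})
    (y : 'I_n -> \bar R) : R :=
  \sum_(i in S | i \in z)
     phi (if choice then rank_in S y i else rank_ctrl S z y i).

(* G_{R,phi,S}(c) : A_S uniform over subsets of S of size nS1 (the treated set) *)
Definition G_S (choice : bool) (phi : nat -> R) (S : {set 'I_n}) (nS1 : nat)
    (y0 : 'I_n -> R) (c : R) : R :=
  (#|[set A : {set 'I_n} | [&& A \subset S, #|A| == nS1 &
        c <= t_stat choice phi S A (fun i => (y0 i)%:E)]]|%:R)
  / (#|[set A : {set 'I_n} | (A \subset S) && (#|A| == nS1)]|%:R).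

(* sample space: (Z, (M(1), M(0))), Z encoded as the set of treated units *)
Definition Omega := ({set 'I_n} * ({ffun 'I_n -> bool} * {ffun 'I_n -> bool}))%type.

Definition Zof (w : Omega) : {set 'I_n} := w.1.
Definition M1of (w : Omega) : {ffun 'I_n -> bool} := w.2.1.
Definition M0of (w : Omega) : {ffun 'I_n -> bool} := w.2.2.

Definition Mobs (w : Omega) (i : 'I_n) : bool :=
  if i \in Zof w then M1of w i else M0of w i.
Definition Sset (w : Omega) : {set 'I_n} := [set i | Mobs w i].
Definition nS1 (w : Omega) : nat := #|Zof w :&: Sset w|.

(* probability weight: Z uniform on assignments with n1 treated, independent of
   the i.i.d. missingness pairs with P((M_i(1),M_i(0)) = (m,m')) = p m m' *)
Definition weight (n1 : nat) (p : bool -> bool -> R) (w : Omega) : R :=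
  (if #|Zof w| == n1 then ('C(n, n1)%:R)^-1 else 0) *
  \prod_(i : 'I_n) p (M1of w i) (M0of w i).

Definition Prob (n1 : nat) (p : bool -> bool -> R) (E : pred Omega) : R :=
  \sum_(w : Omega | E w) weight n1 p w.

Section Outcomes.
Variables (Y1 Y0 : 'I_n -> R).

Definition tau (i : 'I_n) : R := Y1 i - Y0 i.

(* realized outcome (observed iff i in S) *)
Definition Yobs (w : Omega) (i : 'I_n) : R :=
  if i \in Zof w then Y1 i else Y0 i.

(* J_L : the L largest elements of T w.r.t. the total order given by psi
   (j_l is the element of T whose psi-rank within T equals l) *)
Definition Jtop (T : {set 'I_n}) (Y : 'I_n -> R) (L : nat) : {set 'I_n} :=
  [set i in T | (#|T| - L < rank_in T (fun j => (Y j)%:E) i)%N].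

Definition vvec (w : Omega) (k : nat) (c : R) : 'I_n -> \bar R := fun i =>
  if i \in Jtop (Zof w :&: Sset w) (Yobs w) (nS1 w - k) then -oo%E
  else (Yobs w i - c * (i \in Zof w)%:R)%:E.

Definition pval (choice : bool) (phi : nat -> R) (y0 : 'I_n -> R)
    (w : Omega) (k : nat) (c : R) : R :=
  G_S choice phi (Sset w) (nS1 w) y0
      (t_stat choice phi (Sset w) (Zof w) (vvec w k c)).

Definition Hto (w : Omega) (k : nat) (c : R) : bool :=
  (\sum_(i in Sset w) nat_of_bool ((i \in Zof w) && (c < tau i)%R) <= nS1 w - k)%N.

Definition tau_to (w : Omega) (k : nat) : R :=
  nth 0 (sort <=%R [seq tau i | i <- enum (Zof w :&: Sset w)]) k.-1.

Definition Ito (choice : bool) (phi : nat -> R) (y0 : 'I_n -> R)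
    (alpha : R) (w : Omega) (k : nat) : set R :=
  [set c | alpha < pval choice phi y0 w k c].

End Outcomes.
End Defs.

(* Main.v *)
Require Import Defs.
From HB Require Import structures.
From mathcomp Require Import all_boot all_order all_algebra.
From mathcomp Require Import boolp classical_sets reals constructive_ereal ereal.
Import Order.TTheory GRing.Theory Num.Theory.
Local Open Scope ring_scope.
Local Open Scope classical_set_scope.

(** A rank statistic depends on the treated units only through how many of them
    lie above each control, and is monotone in these counts.  This gives, at every
    sample point, monotonicity of the p-value in [c], and, whenever
    [H^to_{k,c}] holds, that the p-value is at least the oracle randomization
    p-value computed from the true control outcomes [Y_i(0)], simultaneously in
    [k].  Under missingness at random the law of the treated set among the
    observed units is, given [S] and [n_S1], uniform, and a rank statistic under a
    uniform assignment is distribution free; so the oracle p-value is valid and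
    a single bad event of probability at most [alpha] yields (i)-(iii). *)

(** * Ranks in a finite total order *)

Section RelationRank.
Context {I : finType}.
Implicit Types (le : rel I) (S : {set I}) (i j : I).

Definition rk le S i : nat := #|[set j in S | le j i]|.

Lemma rk_leq_card le S i : (rk le S i <= #|S|)%N.
Proof. by apply/subset_leq_card/fintype.subsetP => j; rewrite inE => /andP[]. Qed.

Variable le : rel I.
Hypotheses (le_anti : antisymmetric le) (le_trans : transitive le)
           (le_total : total le).

Lemma rk_leq S i j : i \in S -> (rk le S i <= rk le S j)%N = le i j.
Proof.
move=> iS; apply/idP/idP => [|leij]; last first.
  apply/subset_leq_card/fintype.subsetP => h; rewrite !inE => /andP[-> /=].
  by move=> /le_trans; apply.
apply: contraTT => nij; rewrite -ltnNge; apply: proper_card.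
have leji : le j i by case/orP: (le_total i j) nij => [->|].
apply/properP; split.
  by apply/fintype.subsetP => h; rewrite !inE => /andP[-> /= /le_trans]; apply.
by exists i; rewrite !inE iS //=; case/orP: (le_total i i).
Qed.

Lemma rk_inj S : {in S &, injective (rk le S)}.
Proof.
move=> i j iS jS eq_rk; apply: le_anti.
by rewrite -(rk_leq S) // -(rk_leq S) // eq_rk leqnn.
Qed.

(** Ranks are distinct by [rk_inj], at least 1 since each element counts itself, and at most [#|S|];
    so many distinct values fill the whole range. *)
Lemma perm_rk S : perm_eq [seq rk le S i | i <- enum S] (iota 1 #|S|).
Proof.
have uS : uniq [seq rk le S i | i <- enum S].
  by rewrite map_inj_in_uniq ?enum_uniq // => i j; rewrite !mem_enum; apply: rk_inj.
apply: uniq_perm (iota_uniq _ _) _ => //.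
suff sub : {subset [seq rk le S i | i <- enum S] <= iota 1 #|S|}.
  by case: (uniq_min_size uS sub); rewrite ?size_iota ?size_map -?cardE.
move=> m /mapP[i]; rewrite mem_enum => iS ->.
rewrite mem_iota add1n ltnS rk_leq_card andbT card_gt0.
by apply/set0Pn; exists i; rewrite inE iS; case/orP: (le_total i i).
Qed.

(** The right side does not mention [le]: tallies of ranks over a whole set are the same for every
    total order. *)
Lemma card_rk S (P : pred nat) :
  #|[set i in S | P (rk le S i)]| = count P (iota 1 #|S|).
Proof.
rewrite -(permP (perm_rk S)) count_map -sum1_count big_enum_cond -sum1_card.
by apply: eq_bigl => i; rewrite inE.
Qed.

Lemma rk_surj S m : (m < #|S|)%N -> exists2 i, i \in S & rk le S i = m.+1.
Proof.
move=> mS; have: m.+1 \in iota 1 #|S| by rewrite mem_iota add1n ltnS.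
by rewrite -(perm_mem (perm_rk S)) => /mapP[i]; rewrite mem_enum => iS ->; exists i.
Qed.

End RelationRank.

(** * The total order on units behind [psi] *)

Section OutcomeOrder.
Context {R : realType} {n : nat}.
Implicit Types (y : 'I_n -> \bar R) (S z : {set 'I_n}).

(** This is the condition inside [psi i j (y i) (y j)]. The index tie-break keeps it antisymmetric
    even when [y] repeats a value such as [-oo]. *)
Definition outcome_le y : rel 'I_n :=
  fun j i => (y j < y i)%E || ((y i == y j) && (j <= i)%N).

Lemma outcome_le_anti y : antisymmetric (outcome_le y).
Proof.
move=> i j; rewrite /outcome_le; case: (ltgtP (y i) (y j)) => //= _.
by move=> ij; apply: val_inj; apply: anti_leq.
Qed.

Lemma outcome_le_total y : total (outcome_le y).
Proof.
move=> i j; rewrite /outcome_le; case: (ltgtP (y i) (y j)) => //= _.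
exact: leq_total.
Qed.

Lemma outcome_le_trans y : transitive (outcome_le y).
Proof.
move=> j i h; rewrite /outcome_le => /orP[ij|/andP[/eqP -> ij]].
  by case/orP=> [jh|/andP[/eqP -> _]]; rewrite ?ij // (lt_trans ij jh).
by case/orP=> [->//|/andP[-> jh]]; rewrite (leq_trans ij jh) orbT.
Qed.

Definition outcome_rk_leq y := rk_leq (outcome_le y) (outcome_le_trans y) (outcome_le_total y).

Lemma rank_inE S y i : rank_in S y i = rk (outcome_le y) S i.
Proof.
rewrite /rank_in /rk -sum1_card [RHS](eq_bigl (fun j => (j \in S) && outcome_le y j i)).
  by rewrite big_mkcondr; apply: eq_bigr => j _; rewrite /psi -/(outcome_le y j i); case: ifP.
by move=> j; rewrite inE.
Qed.

Lemma rank_ctrlE S z y i : rank_ctrl S z y i = rk (outcome_le y) (S :\: z) i.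
Proof.
by rewrite -rank_inE /rank_in; apply: eq_bigl => j; rewrite !inE andbC.
Qed.
End OutcomeOrder.

(** Layer-cake argument: [phi a] is [phi 0] plus the nonnegative increments [phi m.+1 - phi m] over
    [m < a], so up to a common constant each sum is a nonnegative combination of its tail counts. *)
Lemma ler_sum_count (R : realDomainType) (I : finType) (T : {set I}) (r r' : I -> nat)
    (phi : nat -> R) :
  {homo phi : a b / (a <= b)%N >-> a <= b} ->
  (forall m, (#|[set i in T | (m < r i)%N]| <= #|[set i in T | (m < r' i)%N]|)%N) ->
  \sum_(i in T) phi (r i) <= \sum_(i in T) phi (r' i).
Proof.
move=> phi_homo le_count; pose N := (\max_(i in T) maxn (r i) (r' i))%N.
have phiE a : (a <= N)%N ->
    phi a = phi 0%N + \sum_(m < N) (phi m.+1 - phi m) *+ (m < a)%N.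
  move=> aN; rewrite [X in _ + X](eq_bigr (fun m : 'I_N =>
    if (m < a)%N then phi m.+1 - phi m else 0)); last by move=> m _; case: ifP.
  rewrite -big_mkcond /= -(big_ord_widen _ (fun m => phi m.+1 - phi m)) //.
  by rewrite -(big_mkord predT (fun m => phi m.+1 - phi m)) telescope_sumr // addrC subrK.
have sumE s : (forall i, i \in T -> (s i <= N)%N) -> \sum_(i in T) phi (s i) =
    phi 0%N *+ #|T| +
    \sum_(m < N) (phi m.+1 - phi m) *+ #|[set i in T | (m < s i)%N]|.
  move=> sN; rewrite (eq_bigr _ (fun i iT => phiE _ (sN i iT))) big_split /= sumr_const.
  congr (_ + _); rewrite exchange_big /=; apply: eq_bigr => m _.
  rewrite sumrMnr; congr (_ *+ _); rewrite -sum1_card big_mkcond [RHS]big_mkcond /=.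
  by apply: eq_bigr => i _; rewrite inE; case: (i \in T) => //=; case: (_ < _)%N.
rewrite !sumE => [|i iT|i iT]; first last.
- by apply: leq_trans (leq_bigmax_cond _ iT); rewrite leq_maxl.
- by apply: leq_trans (leq_bigmax_cond _ iT); rewrite leq_maxr.
rewrite lerD2l; apply: ler_sum => m _.
by rewrite ler_wpMn2l ?le_count // subr_ge0 phi_homo.
Qed.

(** * Monotonicity of rank statistics *)

Section RankStatistic.
Context {R : realType} {n : nat}.
Variables (choice : bool) (phi : nat -> R).
Implicit Types (y : 'I_n -> \bar R) (S z : {set 'I_n}).

Lemma t_statE S z y : t_stat choice phi S z y =
  \sum_(i in S :&: z) phi (rk (outcome_le y) (if choice then S else S :\: z) i).
Proof.
rewrite /t_stat; apply: eq_big => [i|i _]; first by rewrite inE.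
by case: choice; rewrite ?rank_inE ?rank_ctrlE.
Qed.

Lemma t_stat_capr S z y : t_stat choice phi S (z :&: S) y = t_stat choice phi S z y.
Proof.
rewrite !t_statE (_ : S :&: (z :&: S) = S :&: z); last by rewrite finset.setICA finset.setIid finset.setIC.
by rewrite (_ : S :\: (z :&: S) = S :\: z) // finset.setDIr finset.setDv finset.setU0.
Qed.

Lemma card_set_neg (T : {set 'I_n}) (P : pred 'I_n) :
  #|[set i in T | ~~ P i]| = (#|T| - #|[set i in T | P i]|)%N.
Proof.
rewrite -(cardsID [set i | P i] T) (_ : T :&: _ = [set i in T | P i]).
  by rewrite addKn; congr #|pred_of_set _|; apply/setP => i; rewrite !inE andbC.
by apply/setP => i; rewrite !inE.
Qed.

(** Units below [j] are split into controls and treated; a treated unit differs from [j], so it is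
    below [j] exactly when it is not above. *)
Lemma rk_control S z y j : j \in S :\: z -> rk (outcome_le y) S j =
  (rk (outcome_le y) (S :\: z) j +
   (#|S :&: z| - #|[set i in S :&: z | outcome_le y j i]|))%N.
Proof.
move=> jC; rewrite /rk -(cardsID z [set i in S | _]) addnC; congr (_ + _)%N.
  by congr #|pred_of_set _|; apply/setP => i; rewrite !inE andbA.
rewrite -card_set_neg.
congr #|pred_of_set _|; apply/setP => i; rewrite !inE andbAC.
apply: andb_id2l => /andP[_ iz]; apply/idP/idP => [ij|]; last first.
  by case/orP: (outcome_le_total y i j) => ->.
apply/negP => ji; have ijE : i = j by apply: (outcome_le_anti y); rewrite ij.
by move: jC; rewrite -ijE inE iz.
Qed.

(* A treated unit has rank above [m] among controls iff it is above the control
   of rank [m.+1]; ranks over all of [S] are a permutation of [1 .. #|S|], so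
   pushing controls down pushes treated units up. *)
Lemma t_stat_dominated S z y y' :
  {homo phi : a b / (a <= b)%N >-> a <= b} ->
  {in S :\: z, y =1 y'} ->
  (forall j, j \in S :\: z -> (#|[set i in S :&: z | outcome_le y j i]| <=
     #|[set i in S :&: z | outcome_le y' j i]|)%N) ->
  t_stat choice phi S z y <= t_stat choice phi S z y'.
Proof.
move=> phi_homo yC le_above; rewrite !t_statE; apply: ler_sum_count => // m.
have rkC j : j \in S :\: z ->
    rk (outcome_le y) (S :\: z) j = rk (outcome_le y') (S :\: z) j.
  move=> jC; congr #|pred_of_set _|; apply/setP => i; rewrite !inE.
  by apply: andb_id2l => iC; rewrite /outcome_le !yC // inE.
case: choice.
  have treatedE y1 : #|[set i in S :&: z | (m < rk (outcome_le y1) S i)%N]| =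
      (count (fun r => m < r)%N (iota 1 #|S|) -
       #|[set i in S :\: z | (m < rk (outcome_le y1) S i)%N]|)%N.
    rewrite -(card_rk _ (outcome_le_anti y1) (outcome_le_trans y1) (outcome_le_total y1)).
    rewrite -(cardsID z [set i in S | _]) (_ : _ :\: z = [set i in S :\: z | (m < rk (outcome_le y1) S i)%N]).
      by rewrite addnK; congr #|pred_of_set _|; apply/setP => i; rewrite !inE andbAC.
    by apply/setP => i; rewrite !inE andbA.
  rewrite !treatedE leq_sub2l //; apply/subset_leq_card/fintype.subsetP => j.
  rewrite !inE => /andP[jSz mj]; have jC : j \in S :\: z by rewrite inE.
  move: mj; rewrite jSz !(rk_control S z _ j) // => /leq_trans; apply.
  by rewrite rkC // leq_add2l leq_sub2l // le_above.
(* If there are at most [m] controls, no rank among controls exceeds [m] and the left count is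
   zero. *)
case: (ltnP m #|S :\: z|) => [mC|Cm]; last first.
  rewrite (_ : [set i in S :&: z | _] = finset.set0) ?cards0 //.
  apply/setP => i; rewrite !inE; apply/negbTE; rewrite negb_and orbC -leqNgt.
  by rewrite (leq_trans (rk_leq_card _ _ _)).
have [j jC rkj] := rk_surj _ (outcome_le_anti y) (outcome_le_trans y) (outcome_le_total y) _ _ mC.
have aboveE y1 : rk (outcome_le y1) (S :\: z) j = m.+1 ->
    [set i in S :&: z | (m < rk (outcome_le y1) (S :\: z) i)%N] =
    [set i in S :&: z | outcome_le y1 j i].
  by move=> e; apply/setP => i; rewrite !inE -e outcome_rk_leq.
by rewrite !aboveE -?rkC // le_above.
Qed.
End RankStatistic.

(** Let [a] be a bad element with the smallest statistic. All bad elements lie in the upper tail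
    starting at [s a], and that tail has relative size at most [alpha] because [a] is bad. *)
Lemma randomization_valid (R : realFieldType) (T : finType) (X : {set T}) (s : T -> R)
    (alpha : R) : 0 <= alpha ->
  #|[set a in X | #|[set b in X | s a <= s b]|%:R / #|X|%:R <= alpha]|%:R <= alpha * #|X|%:R.
Proof.
move=> alpha_ge0; set bad := [set a in X | _].
have [->|[a0 a0bad]] := set_0Vmem bad; first by rewrite cards0 mulr_ge0.
case: (arg_minP s a0bad) => a abad a_min.
have: a \in bad by []; rewrite inE => /andP[aX a_small].
have X_gt0 : 0 < #|X|%:R :> R by rewrite ltr0n card_gt0; apply/set0Pn; exists a.
rewrite -ler_pdivrMr //; apply: le_trans a_small.
rewrite ler_pM2r ?invr_gt0 // ler_nat; apply/subset_leq_card/fintype.subsetP => b bbad.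
by rewrite inE a_min // andbT; move: bbad; rewrite inE => /andP[].
Qed.

(** * Distribution-freeness and validity under a uniform assignment *)

Section RandomizationTest.
Context {R : realType} {n : nat}.
Variables (choice : bool) (phi : nat -> R).
Local Open Scope set_scope.
Implicit Types (y : 'I_n -> \bar R) (S A : {set 'I_n}).

(** Ranks never exceed [n], so [inord] loses nothing; a finite codomain lets assignments be mapped
    to sets of ranks. *)
Definition rank_ord S y i : 'I_n.+1 := inord (rk (outcome_le y) S i).

Lemma val_rank_ord S y i : rank_ord S y i = rk (outcome_le y) S i :> nat.
Proof.
by rewrite inordK // ltnS (leq_trans (rk_leq_card _ _ _)) // -[X in (_ <= X)%N]card_ord max_card.
Qed.

Lemma rank_ord_inj S y : {in S &, injective (rank_ord S y)}.
Proof.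
move=> i j iS jS /(congr1 val) /=; rewrite !val_rank_ord.
exact: (rk_inj _ (outcome_le_anti y) (outcome_le_trans y) (outcome_le_total y)).
Qed.

Definition ranks_of S : {set 'I_n.+1} := [set r : 'I_n.+1 | (r : nat) \in iota 1 #|S|].

Lemma rank_ord_imset S y : rank_ord S y @: S = ranks_of S.
Proof.
have perm := perm_rk _ (outcome_le_anti y) (outcome_le_trans y) (outcome_le_total y) S.
apply/setP => r; rewrite inE -(perm_mem perm); apply/imsetP/mapP => -[i].
  by move=> iS ->; exists i; rewrite ?mem_enum // val_rank_ord.
by rewrite mem_enum => iS rE; exists i => //; apply: val_inj; rewrite /= val_rank_ord.
Qed.

(** The statistic as a function of the set [B] of treated ranks; no outcome vector enters. *)
Definition rank_stat S (B : {set 'I_n.+1}) : R :=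
  \sum_(r in B) phi (if choice then r : nat
                     else #|[set r' in ranks_of S :\: B | (r' <= r)%N]|).

(** On [S], [rank_ord] is an order isomorphism onto [ranks_of S], so the controls below a unit
    correspond to the control ranks below its rank. *)
Lemma t_stat_rank S A y : A \subset S ->
  t_stat choice phi S A y = rank_stat S (rank_ord S y @: A).
Proof.
move=> AS; have inS i : i \in A -> i \in S by apply: (fintype.subsetP AS).
rewrite t_statE (finset.setIidPr AS) /rank_stat big_imset /=; last first.
  by move=> i j /inS iS /inS jS; apply: rank_ord_inj.
apply: eq_bigr => i iA; case: choice; rewrite ?val_rank_ord //; congr phi.
have rk_ctrl_inj : {in [set j in S :\: A | outcome_le y j i] &, injective (rank_ord S y)}.
  by move=> j h; rewrite !inE => /andP[/andP[_ jS] _] /andP[/andP[_ hS] _]; apply: rank_ord_inj.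
rewrite /rk -(card_in_imset rk_ctrl_inj); congr #|pred_of_set _|; apply/setP => r.
apply/imsetP/idP => [[j]|].
  rewrite 3!inE => /andP[/andP[jA jS] ji] ->.
  rewrite finset.in_setD -(rank_ord_imset S y) (imset_f _ jS) andbT val_rank_ord -/(rk _ S i) outcome_rk_leq // ji andbT.
  by apply/imsetP => -[h hA] /(rank_ord_inj _ _ _ _ jS (inS _ hA)) jh; rewrite jh hA in jA.
rewrite finset.in_set finset.in_setD -(rank_ord_imset S y) -andbA => /and3P[rA /imsetP[j jS rE]].
rewrite rE val_rank_ord -/(rk _ S i) outcome_rk_leq // => ji; exists j => //.
by rewrite !inE jS ji !andbT; apply: contraNN rA => jA; rewrite rE imset_f.
Qed.

(** Taking treated ranks is a size-preserving bijection from subsets of [S] to subsets of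
    [ranks_of S], and the right side is free of [y]. *)
Lemma card_t_stat_ge S m c y :
  #|[set A : {set 'I_n} | [&& A \subset S, #|A| == m & c <= t_stat choice phi S A y]]| =
  #|[set B : {set 'I_n.+1} | [&& B \subset ranks_of S, #|B| == m & c <= rank_stat S B]]|.
Proof.
set X := [set A | _]; pose f A := rank_ord S y @: A.
have inj_on A : A \subset S -> {in A &, injective (rank_ord S y)}.
  by move=> /fintype.subsetP AS i j /AS iS /AS jS; apply: rank_ord_inj.
have f_sub A A' : A \subset S -> A' \subset S -> f A = f A' -> A \subset A'.
  move=> AS A'S fE; apply/fintype.subsetP => i iA.
  have: rank_ord S y i \in f A' by rewrite -fE imset_f.
  case/imsetP=> j jA' /(rank_ord_inj _ _ _ _ (fintype.subsetP AS _ iA)).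
  by move=> -> //; apply: (fintype.subsetP A'S).
have f_inj : {in X &, injective f}.
  move=> A A'; rewrite !inE => /and3P[AS _ _] /and3P[A'S _ _] fE.
  by apply/eqP; rewrite finset.eqEsubset; apply/andP; split; apply: f_sub.
rewrite -(card_in_imset f_inj); congr #|pred_of_set _|; apply/setP => B.
rewrite inE; apply/imsetP/idP => [[A]|/and3P[BR Bm Bc]].
  rewrite inE => /and3P[AS Am Ac] ->; rewrite -t_stat_rank // Ac andbT.
  by rewrite (card_in_imset (inj_on A AS)) Am andbT -(rank_ord_imset S y) imsetS.
pose A := [set i in S | rank_ord S y i \in B].
have AS : A \subset S by apply/fintype.subsetP => i; rewrite inE => /andP[].
have BE : B = f A.
  apply/setP => r; apply/idP/imsetP => [rB|[i]]; last by rewrite inE => /andP[_ iB] ->.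
  have := fintype.subsetP BR _ rB; rewrite -(rank_ord_imset S y) => /imsetP[i iS rE].
  by exists i => //; rewrite inE iS -rE.
exists A => //; rewrite inE AS t_stat_rank // -/(f A) -BE Bc andbT /=.
by rewrite -(eqP Bm) BE /f (card_in_imset (inj_on A AS)).
Qed.

(* [G_S] counts classical sets; the finite sets here have computable membership. *)
Lemma G_SE S m (y0 : 'I_n -> R) c : G_S choice phi S m y0 c =
  #|[set A : {set 'I_n} | [&& A \subset S, #|A| == m &
       c <= t_stat choice phi S A (fun i => (y0 i)%:E)]]|%:R /
  #|[set A : {set 'I_n} | (A \subset S) && (#|A| == m)]|%:R.
Proof.
rewrite /G_S; congr (_%:R / _%:R); apply: eq_card => A.
  by rewrite [RHS]inE; apply: asboolb.
by rewrite [RHS]inE; apply: asboolb.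
Qed.

(** Allows the arbitrary reference vector [y0] to be traded for the true control outcomes. *)
Lemma G_S_free S m (y0 y : 'I_n -> R) c :
  G_S choice phi S m y0 c = G_S choice phi S m y c.
Proof. by rewrite !G_SE !card_t_stat_ge. Qed.

Lemma G_S_antitone S m (y0 : 'I_n -> R) :
  {homo G_S choice phi S m y0 : a b / a <= b >-> b <= a}.
Proof.
move=> a b ab; rewrite !G_SE ler_wpM2r ?invr_ge0 ?ler0n // ler_nat.
apply/subset_leq_card/fintype.subsetP => A; rewrite !inE => /and3P[-> ->] /=.
exact: le_trans.
Qed.

Lemma G_S_valid S m (y0 y : 'I_n -> R) (alpha : R) : 0 <= alpha ->
  #|[set A : {set 'I_n} | [&& A \subset S, #|A| == m &
       G_S choice phi S m y0 (t_stat choice phi S A (fun i => (y i)%:E)) <= alpha]]|%:R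
  <= alpha * #|[set A : {set 'I_n} | (A \subset S) && (#|A| == m)]|%:R.
Proof.
move=> alpha_ge0; set bad := [set A | [&& _, _ & _]]; set X := [set A | _].
pose s A := t_stat choice phi S A (fun i => (y i)%:E).
have := randomization_valid _ _ X s _ alpha_ge0; rewrite (_ : [set a in X | _] = bad) //.
apply: eq_finset => A; rewrite inE (G_S_free _ _ _ y) G_SE andbA.
congr (_ && (_%:R / _ <= _)).
by apply: eq_card => A'; rewrite !inE andbA.
Qed.

End RandomizationTest.

(** * The law of the treated set among observed units *)

Section Design.
Context {R : realType} {n : nat}.
Local Open Scope set_scope.
Variables (n1 : nat) (p : bool -> bool -> R).
Hypotheses (p_ge0 : forall m m' : bool, 0 <= p m m')
  (p_sum1 : p true true + p true false + p false true + p false false = 1)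
  (n1_le_n : (n1 <= n)%N).
Implicit Types (S A Z : {set 'I_n}) (E : pred (Omega n)).

Lemma weight_ge0 w : 0 <= weight (n := n) n1 p w.
Proof.
apply: mulr_ge0; last by apply: prodr_ge0 => i _.
by case: ifP => // _; rewrite invr_ge0 ler0n.
Qed.

Lemma Prob_subset E E' : (forall w, E w -> E' w) -> Prob n1 p E <= Prob n1 p E'.
Proof.
move=> sEE'; rewrite /Prob big_mkcond [leRHS]big_mkcond /=; apply: ler_sum => w _.
by case: ifP => [/sEE' ->|_] //; case: ifP => // _; apply: weight_ge0.
Qed.

(** Marginal of the missingness pair: the chance that a unit assigned to arm [z] has observation
    status [s]. *)
Definition observed_prob (z s : bool) : R :=
  \sum_(m : bool * bool | (if z then m.1 else m.2) == s) p m.1 m.2.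

Lemma observed_prob_total z : observed_prob z true + observed_prob z false = 1.
Proof.
rewrite -p_sum1 /observed_prob; transitivity (\sum_(m : bool * bool) p m.1 m.2).
  rewrite [RHS](bigID (fun m => (if z then m.1 else m.2) == true)) /=; congr (_ + _).
  by apply: eq_bigl => m; case: (if z then _ else _).
by rewrite -(pair_bigA _ p) /= !big_bool /= addrA.
Qed.

(** Once the assignment is fixed, the event [Sset w == S] constrains each unit separately, so the
    sum over missingness pairs factors. [zip] and [unzip] merge the two missingness functions into
    one function to pairs. *)
Lemma Prob_Z_S Z S : Prob n1 p (fun w => (Zof w == Z) && (Sset w == S)) =
  (if #|Z| == n1 then ('C(n, n1)%:R)^-1 else 0) *
  \prod_(i : 'I_n) observed_prob (i \in Z) (i \in S).
Proof.
pose unzip (f : {ffun 'I_n -> bool * bool}) : Omega n :=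
  (Z, ([ffun i => (f i).1], [ffun i => (f i).2])).
pose zip (w : Omega n) : {ffun 'I_n -> bool * bool} := [ffun i => (M1of w i, M0of w i)].
rewrite /Prob (reindex_onto unzip zip) => [|[Z' [M1 M0]] /andP[/eqP ZE _]]; last first.
  by rewrite /unzip -ZE; congr (_, (_, _)); apply/ffunP => i; rewrite !ffunE.
rewrite bigA_distr_big_dep mulr_sumr; apply: eq_big => [f|f _].
  rewrite /Zof /= eqxx /=.
  have -> : zip (unzip f) == f by apply/eqP/ffunP => i; rewrite !ffunE -surjective_pairing.
  rewrite andbT; apply/eqP/familyP => [<- i|fS].
    by rewrite !inE /Mobs /M1of /M0of /= !ffunE unfold_in.
  by apply/setP => i; move/(_ i): fS; rewrite !inE /Mobs /M1of /M0of /= !ffunE => /eqP.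
by rewrite /weight; congr (_ * _); apply: eq_bigr => i _; rewrite /M1of /M0of /= !ffunE.
Qed.

(** Summing over [S] first makes every unit contribute [observed_prob_total]; what remains is the
    uniform law of [Z], well normalized since [n1 <= n]. *)
Lemma Prob_setT : Prob (n := n) n1 p predT = 1.
Proof.
rewrite /Prob (partition_big (@Zof n) predT) //=.
rewrite (eq_bigr (fun Z => if #|Z| == n1 then ('C(n, n1)%:R : R)^-1 else 0)); last first.
  move=> Z _; rewrite (partition_big (@Sset n) predT) //=.
  rewrite (eq_bigr _ (fun S _ => Prob_Z_S Z S)) -mulr_sumr -[RHS]mulr1; congr (_ * _).
  rewrite (eq_bigr (fun S : {set 'I_n} => \prod_i
    (if i \in S then observed_prob (i \in Z) true else observed_prob (i \in Z) false))).
    by rewrite -bigA_distr big1 // => i _; apply: observed_prob_total.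
  by move=> S _; apply: eq_bigr => i _; case: (i \in S).
rewrite -big_mkcond sumr_const (_ : #|_| = 'C(n, n1)); last first.
  by rewrite -[n in RHS]card_ord -card_draws cardsE.
by rewrite -[LHS]mulr_natr mulVf // pnatr_eq0 -lt0n bin_gt0.
Qed.

Definition stratum_weight S A : R :=
  Prob n1 p (fun w => (Sset w == S) && (Zof w :&: Sset w == A)).

(** Here missingness at random enters: after summing over the unobserved treated units, only
    cardinalities remain, so given [S] and [n_S1] the treated set is uniform. *)
Lemma stratum_weight_card S A A' : A \subset S -> A' \subset S -> #|A| = #|A'| ->
  stratum_weight S A = stratum_weight S A'.
Proof.
pose q b s := observed_prob b s.
(* [a] and [b] count the treated units inside and outside [S]; the four powers group units by arm
   and observation status. *)
pose F (a b : nat) : R := (if (a + b)%N == n1 then ('C(n, n1)%:R)^-1 else 0) *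
  (q true true ^+ a * q false true ^+ (#|S| - a) *
   (q true false ^+ b * q false false ^+ (#|~: S| - b))).
have prod_q (T U : {set 'I_n}) s : U \subset T ->
    \prod_(i in T) q (i \in U) s = q true s ^+ #|U| * q false s ^+ (#|T| - #|U|).
  move=> UT; rewrite (big_setID U) /= (finset.setIidPr UT) -cardsDS //.
  by rewrite -!prodr_const; congr (_ * _); apply: eq_bigr => i;
    [move=> -> | rewrite inE => /andP[/negbTE ->]].
suff sumE (B : {set 'I_n}) : B \subset S -> stratum_weight S B =
    \sum_(C : {set 'I_n} | C \subset ~: S) F #|B| #|C|.
  by move=> AS A'S AA'; rewrite !sumE // AA'.
move=> BS; rewrite /stratum_weight /Prob.
rewrite (partition_big (@Zof n) (fun Z => Z :&: S == B)); last first.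
  by move=> w /andP[/eqP <-].
(* An assignment that meets [S] in [B] is determined by its part [C] outside [S]. *)
rewrite (reindex_onto (fun C => B :|: C) (fun Z => Z :\: S)) => [|Z /eqP <-]; last first.
  exact: finset.setID.
have BCS (C : {set 'I_n}) : C \subset ~: S -> (B :|: C) :&: S = B.
  move=> CS; rewrite finset.setIUl (finset.setIidPl BS) (finset.disjoint_setI0 _) ?finset.setU0 //.
  by rewrite finset.disjoints_subset.
apply: eq_big => [C|C /andP[_ /eqP CE]].
  apply/andP/idP => [[_ /eqP <-]|CS]; first by rewrite finset.setDE finset.subsetIr.
  rewrite BCS // eqxx finset.setDUl.
  have -> : B :\: S = finset.set0 by apply/eqP; rewrite finset.setD_eq0.
  rewrite finset.set0U; split=> //; apply/eqP/finset.setDidPl.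
  by rewrite finset.disjoints_subset.
have CS : C \subset ~: S by rewrite -CE finset.setDE finset.subsetIr.
transitivity (Prob n1 p (fun w => (Zof w == B :|: C) && (Sset w == S))).
  apply: eq_bigl => w; rewrite -andbA.
  apply/and3P/andP => [[-> _ ->] //|[/eqP Zw /eqP Sw]].
  by rewrite Zw Sw BCS // !eqxx.
have BC0 : B :&: C = finset.set0.
  apply: finset.disjoint_setI0; rewrite finset.disjoints_subset.
  by rewrite (fintype.subset_trans BS) // -finset.setCS finset.setCK.
rewrite Prob_Z_S cardsU BC0 cards0 subn0; congr (_ * _).
rewrite (bigID (fun i => i \in S)) /=; congr (_ * _).
  rewrite -prod_q //; apply: eq_bigr => i iS; rewrite inE iS (_ : i \in C = false) ?orbF //.
  by apply/negbTE; apply: contraL iS => /(fintype.subsetP CS); rewrite inE.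
rewrite -prod_q //; apply: eq_big => [i|i iS]; rewrite !inE // (negbTE iS).
by rewrite (_ : i \in B = false) //; apply: contraNF iS => /(fintype.subsetP BS).
Qed.

Lemma Prob_stratify (e : {set 'I_n} -> {set 'I_n} -> bool) :
  Prob n1 p (fun w => e (Sset w) (Zof w :&: Sset w)) =
  \sum_(S : {set 'I_n}) \sum_(A : {set 'I_n} | (A \subset S) && e S A) stratum_weight S A.
Proof.
rewrite /Prob (partition_big (@Sset n) predT) //=; apply: eq_bigr => S _.
rewrite (partition_big (fun w => Zof w :&: Sset w) (fun A => (A \subset S) && e S A)) /=.
  apply: eq_bigr => A /andP[_ eSA]; apply: eq_bigl => w.
  by case: eqP => [->|]; rewrite ?andbF // andbT; case: eqP => [->|]; rewrite ?eSA ?andbF.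
by move=> w /andP[ew /eqP <-]; rewrite ew finset.subsetIr.
Qed.

(** Weights are constant on each stratum given by [S] and the treated count, so the counting bound
    becomes a bound on weights; the total mass 1, stratified in the same way, supplies the right
    side. *)
Lemma Prob_valid (e : {set 'I_n} -> {set 'I_n} -> bool) (alpha : R) :
  (forall S m, #|[set A : {set 'I_n} | [&& A \subset S, #|A| == m & e S A]]|%:R <=
     alpha * #|[set A : {set 'I_n} | (A \subset S) && (#|A| == m)]|%:R) ->
  Prob n1 p (fun w => e (Sset w) (Zof w :&: Sset w)) <= alpha.
Proof.
move=> e_small; rewrite -[leRHS]mulr1 -Prob_setT (Prob_stratify (fun _ _ => true)).
rewrite Prob_stratify mulr_sumr; apply: ler_sum => S _.
have splitE (P : pred {set 'I_n}) : \sum_(A | P A) stratum_weight S A =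
    \sum_(m < n.+1) \sum_(A | P A && (#|A| == m)) stratum_weight S A.
  rewrite (partition_big (fun A => inord #|A| : 'I_n.+1) predT) //=.
  apply: eq_bigr => m _; apply: eq_bigl => A; congr (_ && _).
  by rewrite -val_eqE /= inordK // ltnS -[leqRHS]card_ord max_card.
rewrite !splitE mulr_sumr; apply: ler_sum => m _.
have constE (P : pred {set 'I_n}) A0 : A0 \subset S -> #|A0| = m ->
    (forall A, P A -> A \subset S) -> \sum_(A | P A && (#|A| == m)) stratum_weight S A =
    stratum_weight S A0 * #|[set A | P A && (#|A| == m)]|%:R.
  move=> A0S A0m PS; rewrite mulr_natr -sumr_const; apply: eq_big => [A|A /andP[PA /eqP Am]].
    by rewrite inE.
  exact: stratum_weight_card (PS _ PA) A0S (etrans Am (esym A0m)).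
(* Any [A0] in the stratum represents its constant weight; an empty stratum gives zero on both
   sides. *)
case: (set_0Vmem [set A : {set 'I_n} | (A \subset S) && (#|A| == m)]) => [X0|[A0]]; last first.
  rewrite inE => /andP[A0S /eqP A0m].
  rewrite !(constE _ A0) //; [|by move=> A /andP[]..].
  rewrite mulrCA ler_wpM2l ?sumr_ge0 // => [w _|]; first exact: weight_ge0.
  have -> : [set A : {set 'I_n} | (A \subset S) && e S A && (#|A| == m)] =
     [set A : {set 'I_n} | [&& A \subset S, #|A| == m & e S A]].
    by apply/setP => A; rewrite !inE andbAC -andbA.
  have -> : [set A : {set 'I_n} | (A \subset S) && true && (#|A| == m)] =
     [set A : {set 'I_n} | (A \subset S) && (#|A| == m)].
    by apply/setP => A; rewrite !inE andbT.
  exact: e_small.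
have none A : A \subset S -> (#|A| == m) = false.
  by move=> AS; move/setP/(_ A): X0; rewrite !inE AS.
by rewrite !big_pred0 ?mulr0 // => A; apply/negbTE; apply/negP => /andP[/andP[/none ->]].
Qed.
End Design.

(** The interval is closed or open according to whether the infimum is attained. With an
    extended-real infimum, the empty set and the whole line fall under the unattained case. *)
Lemma upclosed_interval (R : realType) (I : set R) :
  (forall c c', c <= c' -> I c -> I c') ->
  let t := ereal_inf [set c%:E | c in I] in
  I = [set c | (t <= c%:E)%E] \/ I = [set c | (t < c%:E)%E].
Proof.
move=> I_up t.
have t_le c : I c -> (t <= c%:E)%E by move=> Ic; apply: ereal_inf_lbound; exists c.
have [[c0 [Ic0 tE]]|t_out] := pselect (exists c0, I c0 /\ t = c0%:E).
  left; apply/seteqP; split=> c /=; first exact: t_le.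
  by rewrite tE lee_fin => /I_up; apply.
right; apply/seteqP; split=> c /=.
  move=> Ic; rewrite lt_neqAle t_le // andbT; apply/negP => /eqP tE.
  by apply: t_out; exists c.
by move=> /ereal_inf_lt[_ [c' Ic' <-]]; rewrite lte_fin => /ltW /I_up; apply.
Qed.

(** * The imputed vector [vvec]: monotonicity in [c] and comparison with the true controls *)

Section ShiftedOutcomes.
Context {R : realType} {n : nat}.
Variables (Y1 Y0 : 'I_n -> R) (choice : bool) (phi : nat -> R).
Local Open Scope set_scope.
Implicit Types (w : Omega n) (T : {set 'I_n}).

Lemma outcome_le_mono (y y' : 'I_n -> \bar R) j i :
  (y' j <= y j)%E -> (y i <= y' i)%E -> outcome_le y j i -> outcome_le y' j i.
Proof.
rewrite /outcome_le => yj yi /orP[ji|/andP[/eqP ij ji]].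
  by rewrite (le_lt_trans yj (lt_le_trans ji yi)).
by rewrite ji andbT eq_sym orbC -le_eqVlt (le_trans yj) // -ij.
Qed.

(** Ranks in [T] run once through [1 .. #|T|], and exactly [L] of these exceed [#|T| - L]. *)
Lemma card_Jtop T (Y : 'I_n -> R) L : (L <= #|T|)%N -> #|Jtop T Y L| = L.
Proof.
move=> LT; pose y i := (Y i)%:E.
have -> : Jtop T Y L = [set i in T | (#|T| - L < rk (outcome_le y) T i)%N].
  by apply/setP => i; rewrite !inE rank_inE.
rewrite (card_rk _ (outcome_le_anti y) (outcome_le_trans y) (outcome_le_total y)).
rewrite -{2}(subnK LT) iotaD count_cat (eq_in_count (a2 := pred0)) => [|r]; last first.
  by rewrite mem_iota add1n ltnS => /andP[_]; rewrite ltnNge => ->.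
rewrite count_pred0 (eq_in_count (a2 := predT)) => [|r]; last first.
  by rewrite mem_iota add1n => /andP[].
by rewrite count_predT size_iota.
Qed.

Lemma vvec_control w k c j : j \in Sset w :\: Zof w -> vvec Y1 Y0 w k c j = (Y0 j)%:E.
Proof.
rewrite !inE => /andP[jZ _].
by rewrite /vvec !inE /Yobs (negbTE jZ) /= mulr0 subr0.
Qed.

(** The top set is chosen from [Yobs] alone, so raising [c] only lowers the other treated entries
    while the controls stay fixed. *)
Lemma t_stat_vvec_antitone w k c c' : {homo phi : a b / (a <= b)%N >-> a <= b} ->
  c <= c' ->
  t_stat choice phi (Sset w) (Zof w) (vvec Y1 Y0 w k c') <=
  t_stat choice phi (Sset w) (Zof w) (vvec Y1 Y0 w k c).
Proof.
move=> phi_homo cc'; apply: t_stat_dominated => // [j jC|j jC].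
  by rewrite !vvec_control.
apply/subset_leq_card/fintype.subsetP => i; rewrite !inE => /andP[-> /=].
apply: outcome_le_mono; first by rewrite !vvec_control.
rewrite /vvec; case: ifP => // _; rewrite lee_fin lerD2l lerN2.
by apply: ler_wpM2r.
Qed.

(* The treated units above a given control form an upper set, so removing the
   top [n_S1 - k] of them removes at least as many as removing the (at most
   [n_S1 - k]) units with effect above [c]; each remaining unit of the latter
   kind has [Y_i - c <= Y_i(0)]. *)
Lemma t_stat_vvec_le w k c : {homo phi : a b / (a <= b)%N >-> a <= b} ->
  Hto Y1 Y0 w k c ->
  t_stat choice phi (Sset w) (Zof w) (vvec Y1 Y0 w k c) <=
  t_stat choice phi (Sset w) (Zof w) (fun i => (Y0 i)%:E).
Proof.
move=> phi_homo few_large; apply: t_stat_dominated => // j jC.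
  exact: vvec_control.
set T := Sset w :&: Zof w.
have TE : Zof w :&: Sset w = T by rewrite finset.setIC.
pose L := (nS1 w - k)%N; pose J := Jtop T (Yobs Y1 Y0 w) L.
pose u i := (Yobs Y1 Y0 w i - c * (i \in Zof w)%:R)%:E.
have vE i : vvec Y1 Y0 w k c i = if i \in J then -oo%E else u i.
  by rewrite /vvec TE.
have uj : u j = (Y0 j)%:E.
  by move: jC; rewrite inE /u /Yobs => /andP[/negbTE -> _]; rewrite mulr0 subr0.
pose A := [set i in T | outcome_le u j i]; pose B := [set i in T | c < tau Y1 Y0 i].
have cardB : (#|B| <= #|J|)%N.
  rewrite card_Jtop; last by rewrite /L /nS1 TE leq_subr.
  apply: leq_trans few_large; rewrite -sum1_card big_mkcond [leqRHS]big_mkcond /=.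
  apply: leq_sum => i _; rewrite !inE.
  by case: (Mobs w i); case: (i \in Zof w); case: (c < _)%R.
(* Control outcomes are finite, so a unit sent to [-oo] is never above one. *)
have aboveA : [set i in T | outcome_le (vvec Y1 Y0 w k c) j i] = A :\: J.
  apply/setP => i; rewrite [RHS]inE [i \in A]inE [LHS]inE andbCA; congr (_ && _).
  by rewrite /outcome_le (vvec_control _ _ _ _ jC) -uj vE; case: (i \in J).
rewrite aboveA; apply: (@leq_trans #|A :\: B|); last first.
  apply/subset_leq_card/fintype.subsetP => i.
  rewrite !inE => /andP[iB /andP[/andP[iS iZ] ji]]; rewrite iS iZ /=.
  apply: outcome_le_mono ji; first by rewrite uj.
  move: iB; rewrite iS iZ /= -leNgt /u /Yobs iZ mulr1 lee_fin /tau.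
  by rewrite lerBlDr lerBlDl.
have [AJ|[i0]] := set_0Vmem (A :\: J); first by rewrite AJ cards0.
rewrite inE => /andP[i0J i0A].
(* The survivor [i0] is above [j] and ranks below every unit of [J]; treated units share the shift
   [c], so the order of [Yobs] among them is that of [u]. *)
have JA : J \subset A.
  apply/fintype.subsetP => i iJ; move: (iJ) i0J; rewrite !inE.
  move: i0A; rewrite !inE => /andP[/andP[i0S i0Z] ji0].
  move=> /andP[/andP[iS iZ] i_top]; rewrite iS iZ i0S i0Z /= -leqNgt => i0_low.
  apply: outcome_le_trans ji0 _.
  have i0T : i0 \in T by rewrite !inE i0S i0Z.
  have := leq_trans i0_low (ltnW i_top); rewrite !rank_inE outcome_rk_leq //.
  rewrite /outcome_le /u i0Z iZ !lte_fin ltrD2r !eqe.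
  by rewrite (inj_eq (addIr _)).
rewrite !cardsD (finset.setIidPr JA) leq_sub2l // (leq_trans _ cardB) //.
exact/subset_leq_card/finset.subsetIr.
Qed.

(** In the sorted list the first [k] entries are at most the one at index [k.-1], leaving at most
    [nS1 w - k] larger ones. The bounds on [k] keep that index in range, away from the default 0. *)
Lemma Hto_tau_to w k : (0 < k <= nS1 w)%N -> Hto Y1 Y0 w k (tau_to Y1 Y0 w k).
Proof.
case/andP=> k_gt0 kn; rewrite /Hto /tau_to; set s := sort _ _.
set c := nth _ _ _.
have size_s : size s = nS1 w by rewrite size_sort size_map -cardE.
have -> : (\sum_(i in Sset w) nat_of_bool ((i \in Zof w) && (c < tau Y1 Y0 i)%R) =
    count (fun x => (c < x)%R) s)%N.
  rewrite (permP (permEl (perm_sort _ _))) count_map -sum1_count big_enum_cond /=.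
  rewrite [LHS]big_mkcond [RHS]big_mkcond /=; apply: eq_bigr => i _; rewrite !inE.
  by case: (Mobs w i); case: (i \in Zof w); case: (c < _)%R.
have s_sorted : sorted <=%R s by apply: sort_sorted; apply: le_total.
rewrite -(cat_take_drop k s) count_cat (eq_in_count (a2 := pred0)) => [|x]; last first.
  case/(nthP 0) => i; rewrite size_takel ?size_s // => ik <-.
  rewrite nth_take // ltNge; apply/negbF.
  apply: (sorted_leq_nth le_trans lexx 0 s_sorted); rewrite ?inE ?size_s.
  - exact: leq_trans ik kn.
  - by rewrite prednK.
  - by rewrite -ltnS prednK.
by rewrite count_pred0 (leq_trans (count_size _ _)) // size_drop size_s.
Qed.

End ShiftedOutcomes.

Theorem theorem10 (R : realType) (n n1 : nat) (Y1 Y0 : 'I_n -> R)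
    (p : bool -> bool -> R) (choice : bool) (phi : nat -> R) (y0 : 'I_n -> R) :
  (0 < n1)%N -> (n1 < n)%N ->
  (forall m m' : bool, 0 <= p m m') ->
  p true true + p true false + p false true + p false false = 1 ->
  {homo phi : a b / (a <= b)%N >-> a <= b} ->
  forall alpha : R, 0 < alpha < 1 ->
  [/\
   (* (i) *)
   (forall (k : nat) (c : R), (1 <= k)%N ->
      Prob n1 p (fun w => [&& (k <= nS1 w)%N,
                             pval Y1 Y0 choice phi y0 w k c <= alpha &
                             Hto Y1 Y0 w k c]) <= alpha),
   (* (ii) *)
   (forall k : nat, (1 <= k)%N ->
      1 - alpha <= Prob n1 p (fun w => (k <= nS1 w)%N ==>
                       (alpha < pval Y1 Y0 choice phi y0 w k (tau_to Y1 Y0 w k)))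
      /\
      (forall w : Omega n, (k <= nS1 w)%N ->
         let I := Ito Y1 Y0 choice phi y0 alpha w k in
         let t := ereal_inf [set c%:E | c in I] in
         I = [set c | (t <= c%:E)%E] \/ I = [set c | (t < c%:E)%E]))
   &
   (* (iii) *)
   1 - alpha <= Prob n1 p (fun w =>
      all (fun k => alpha < pval Y1 Y0 choice phi y0 w k (tau_to Y1 Y0 w k))
          (iota 1 (nS1 w)))].
Proof.
move=> n1_gt0 n1_lt_n p_ge0 p_sum1 phi_homo alpha /andP[alpha_gt0 _].
have n1_le_n := ltnW n1_lt_n.
(* The oracle test on the true control outcomes: it sees the sample point only through the observed
   set and its treated part, as [Prob_valid] requires. *)
pose e (S A : {set 'I_n}) := G_S choice phi S #|A| y0 (t_stat choice phi S A (fun i => (Y0 i)%:E)) <= alpha.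
pose bad (w : Omega n) := e (Sset w) (Zof w :&: Sset w).
have bad_small : Prob n1 p bad <= alpha.
  apply: Prob_valid => // S m; apply: le_trans (G_S_valid choice phi S m y0 Y0 _ (ltW alpha_gt0)).
  rewrite ler_nat; apply/subset_leq_card/fintype.subsetP => A.
  by rewrite !inE /e => /and3P[-> /eqP ->]; rewrite eqxx.
(* [bad] involves neither [k] nor [c], so it absorbs every false rejection at once. *)
have pval_bad w k c : Hto Y1 Y0 w k c -> pval Y1 Y0 choice phi y0 w k c <= alpha -> bad w.
  move=> H; apply: le_trans; rewrite t_stat_capr.
  exact/G_S_antitone/t_stat_vvec_le.
have likely (E : pred (Omega n)) : (forall w, ~~ E w -> bad w) -> 1 - alpha <= Prob n1 p E.
  move=> notE; rewrite -(Prob_setT n1 p p_sum1 n1_le_n) /Prob (bigID E) /= lerBlDr lerD2l.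
  exact: le_trans (Prob_subset n1 p p_ge0 _ _ notE) bad_small.
split.
- move=> k c _; apply: le_trans bad_small; apply: Prob_subset => // w /and3P[_].
  by move=> ? /pval_bad; apply.
- move=> k k_gt0; split=> [|w _].
    (* The hypothesis with [c] set to [tau_to] always holds, so a coverage failure is a false
       rejection. *)
    apply: likely => w; rewrite negb_imply -leNgt => /andP[kn].
    by apply/pval_bad/Hto_tau_to; rewrite k_gt0.
  apply: upclosed_interval => c c' cc' /lt_le_trans; apply.
  exact/G_S_antitone/t_stat_vvec_antitone.
- apply: likely => w /allPn[k]; rewrite mem_iota add1n ltnS -leNgt => kn.
  exact/pval_bad/Hto_tau_to.
Qed.
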